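(* Let $PG_n$ be the random pentagonal chain network described in the context, and assume Hypotheses 1 and 2 of the context hold. Then: (i) For $n\ge 1$, $$Var\big(Gut(PG_{n})\big)=\frac{1}{30}\Big(\sigma^{2}_{1}n^{5}-5r_{1}n^{4}+10\tilde{\sigma}^{2}_{1}n^{3}+(65r_{1}-30\sigma^{2}_{1}-45\tilde{\sigma}^{2}_{1})n^{2}+(59\sigma^{2}_{1}+65\tilde{\sigma}^{2}_{1}-120r_{1})n+(60r_{1}-30\sigma^{2}_{1}-30\tilde{\sigma}^{2}_{1})\Big),$$ where $\sigma^{2}_{1}=288^{2}p_{1}+432^{2}(1-p_{1})-\big(288p_{1}+432(1-p_{1})\big)^{2}$, $\tilde{\sigma}^{2}_{1}=156^{2}p_{1}+300^{2}(1-p_{1})-\big(156p_{1}+300(1-p_{1})\big)^{2}$, $r_{1}=288\cdot156\cdot p_{1}+432\cdot300\cdot(1-p_{1})-\big(288p_{1}+432(1-p_{1})\big)\big(156p_{1}+300(1-p_{1})\big)$. (ii) $Gut(PG_n)$ is asymptotically normal: $$\lim_{n\rightarrow \infty}\sup_{a\in \mathbb{R}}\Big| \mathbb{P}\Big(\frac{Gut(PG_{n})-\mathbb{E}\big(Gut(PG_{n})\big)}{\sqrt{Var\big(Gut(PG_{n})\big)}}\leq a\Big)-\int^{a}_{-\infty}\frac{1}{\sqrt{2\pi}}e^{-t^{2}/2}\,dt \Big| =0.$$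
   Context: Random chain network $PG_n$: $PG_1$ is a $5$-cycle (pentagon). For $n\ge 1$, $PG_{n+1}$ is obtained from $PG_n$ by adding a new pentagon $O_{n+1}$ with vertices $x_1,\dots,x_5$ in cyclic order and adding one edge joining $x_1$ to a vertex $u_n$ of $PG_n$. The vertex $u_1$ is any vertex of $PG_1$. For $n\ge 2$, $u_n$ is a vertex of the last pentagon $O_n$ (whose vertex $x_1$ is the one joined to $u_{n-1}$): either $u_n\in\{x_2,x_5\}$ of $O_n$ (neighbours of $x_1$ in $O_n$; set $Z_n^1=1$, $Z_n^2=0$) or $u_n\in\{x_3,x_4\}$ of $O_n$ (vertices at distance $2$ from $x_1$ in $O_n$; set $Z_n^1=0$, $Z_n^2=1$), with $\mathbb{P}(Z_n^1=1)=p_1$, $\mathbb{P}(Z_n^2=1)=p_2=1-p_1$, constants independent of $n$. Hypothesis 1: the random vectors $(Z_n^1,Z_n^2)$, $n=2,3,\dots$, are independent. Hypothesis 2: $0<p_i<1$ for $i=1,2$. For a graph $G$, $d(v)$ is the degree of $v$, $d(u,v)$ the shortest-path distance, and the Gutman index is $Gut(G)=\sum_{\{u,v\}\subseteq V_G} d(u)d(v)\,d(u,v)$ over unordered pairs of distinct vertices. *)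

(* Defs.v *)
From HB Require Import structures.
From mathcomp Require Import all_boot all_order all_algebra.
From mathcomp Require Import all_classical all_reals all_analysis.
Set Implicit Arguments. Unset Strict Implicit. Unset Printing Implicit Defensive.
Import Order.TTheory GRing.Theory Num.Theory.

Section graph.
Variable V : finType.
Variable e : rel V.

Fixpoint nball (u : V) (k : nat) : {set V} :=
  if k is k'.+1 then
    nball u k' :|: [set y | [exists x in nball u k', e x y]]
  else [set u].

(* shortest-path distance d(u,v): least k with v within k steps of u
   (in a connected graph every distance is < #|V|) *)
Definition gdist (u v : V) : nat :=
  find (fun k => v \in nball u k) (iota 0 #|V|).

Definition gdeg (u : V) : nat := #|[set v | e u v]|.

(* Gutman index: sum over unordered pairs {u,v} of distinct vertices
   (each unordered pair counted once, via the enumeration order of V) *)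
Definition gutman : nat :=
  \sum_(u : V) \sum_(v : V | (enum_rank u < enum_rank v)%N)
     gdeg u * gdeg v * gdist u v.
End graph.

(* Vertices of PG_n : pairs (k, j), k : 'I_n the (0-based) index of the pentagon
   O_(k+1), j : 'I_5 the vertex x_(j+1) of that pentagon (cyclic order
   x_1,...,x_5).  For k >= 1, x_1 (j = 0) is the vertex joined to the previous
   pentagon.
   z m = true  <->  Z_m^1 = 1  (and Z_m^2 = 0);
   z m = false <->  Z_m^1 = 0  (and Z_m^2 = 1).
   u1 : 'I_5 is the (arbitrary) vertex u_1 of O_1; sel m chooses which of the
   two admissible vertices is u_m  ({x_2,x_5} resp. {x_3,x_4} of O_m). *)

(* index j of the vertex u_(k+1) of pentagon O_(k+1) joined to O_(k+2) *)
Definition pg_att (u1 : 'I_5) (sel z : nat -> bool) (k : nat) : nat :=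
  if k == 0%N then val u1
  else if z k.+1 then (if sel k.+1 then 1%N else 4%N)
       else (if sel k.+1 then 2%N else 3%N).

Definition pg_adj (n : nat) (u1 : 'I_5) (sel z : nat -> bool)
    : rel ('I_n * 'I_5) :=
  fun a b =>
    [|| (a.1 == b.1) &&
          ((val b.2 == (val a.2).+1 %% 5) || (val a.2 == (val b.2).+1 %% 5)),
        [&& val b.1 == (val a.1).+1, val a.2 == pg_att u1 sel z a.1
          & val b.2 == 0%N]
      | [&& val a.1 == (val b.1).+1, val b.2 == pg_att u1 sel z b.1
          & val a.2 == 0%N]].

Arguments pg_adj n u1 sel z : clear implicits.

Definition gut_PG (n : nat) (u1 : 'I_5) (sel z : nat -> bool) : nat :=
  gutman (pg_adj n u1 sel z).

Local Open Scope ring_scope.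
Local Open Scope classical_set_scope.

Definition Z_independent {d} {T : measurableType d} {R : realType}
    (P : probability T R) (Z : nat -> T -> bool) : Prop :=
  forall (s : seq nat) (b : nat -> bool), uniq s -> all (leq 2) s ->
    fine (P [set w | all (fun i => Z i w == b i) s]) =
    \prod_(i <- s) fine (P [set w | Z i w = b i]).

Definition std_normal_cdf {R : realType} (a : R) : R :=
  fine (\int[@lebesgue_measure R]_(t in [set t : R | (t <= a)%R])
          ((Num.sqrt (2 * pi))^-1 * expR (- (t ^+ 2) / 2))%R%:E)%E.

(* Main.v *)
Require Import Defs.
From HB Require Import structures.
From mathcomp Require Import all_boot all_order all_algebra.
From mathcomp Require Import all_classical all_reals all_analysis.
From mathcomp Require Import measurable_realfun zify ring lra.
Set Implicit Arguments. Unset Strict Implicit. Unset Printing Implicit Defensive.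
Import Order.TTheory GRing.Theory Num.Theory.
Import numFieldNormedType.Exports.

(* Number the pentagons 0, ..., n-1 and let delta_m be 1 or 2 according to
   Z_(m+1).  A shortest path crosses pentagon m in delta_m steps when its ends
   lie on both sides of m, so Gut(PG_n) is affine in the delta_m; the coefficient
   of delta_m is the product of (degree sum + 1) over both sides, i.e.
   12 m * 12 (n-1-m).  The variance is thus p q 144^2 \sum_m m^2 (n-1-m)^2.
   The normal limit is Lindeberg's replacement argument with the test functions
   Phi ((a - x) / s): they solve the heat equation in (x, s^2), so replacing one
   two-point variable of scale c by a Gaussian one amounts to changing s^2 into
   s^2 + p q c^2, at a cost O(c^3) uniform in a for s >= d, without constructing
   any Gaussian variable.  As d -> 0 these functions approach the indicator of
   x <= a. *)

Local Open Scope nat_scope.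

(** * Distances and degrees in the pentagonal chain *)

Section distance.
Variables (V : finType) (e : rel V) (D : V -> V -> nat).
Hypothesis D0 : forall u v, D u v = 0 <-> u = v.
Hypothesis D_edge : forall u x y, e x y -> D u y <= (D u x).+1.
Hypothesis D_pred : forall u v k, D u v = k.+1 -> exists2 x, D u x = k & e x v.

(** [D_edge] keeps each ball inside the sublevel set of [D u]; [D_pred] gives the converse by
    supplying a neighbour one step closer to [u]. *)
Lemma mem_nball u v k : (v \in nball e u k) = (D u v <= k).
Proof.
elim: k v => [|k IH] v /=.
  by rewrite finset.in_set1 leqn0; apply/eqP/eqP => [->|/D0 ->//]; apply/D0.
rewrite finset.in_setU IH inE; apply/orP/idP => [[/leqW//|/existsP[x /andP[]]]|].
  by rewrite IH => Dx /(D_edge u) Dv; rewrite (leq_trans Dv).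
rewrite leq_eqVlt ltnS => /orP[/eqP /D_pred[x Dx xv]|]; [right|by left].
by apply/existsP; exists x; rewrite IH Dx leqnn.
Qed.

Lemma gdistE u v : D u v < #|V| -> gdist e u v = D u v.
Proof.
move=> Dlt; rewrite /gdist (eq_find (a2 := leq (D u v))); last first.
  by move=> k /=; rewrite mem_nball.
(* Cutting the search range at [D u v] separates the radii that fail from the first one that
   succeeds; the hypothesis keeps that radius within range. *)
have -> : #|V| = D u v + (#|V| - D u v).-1.+1 by lia.
rewrite iotaD add0n find_cat /= leqnn size_iota addn0.
by case: hasP => // -[k]; rewrite mem_iota add0n; lia.
Qed.

End distance.

(** Doubling removes the enumeration order of the vertices, which is unrelated to their position in
    the chain. *)
Lemma sum_unordered (V : finType) (f : V -> V -> nat) :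
  (forall u, f u u = 0) -> (forall u v, f u v = f v u) ->
  (\sum_u \sum_(v | enum_rank u < enum_rank v) f u v).*2 = \sum_u \sum_v f u v.
Proof.
move=> f0 fC; rewrite -addnn.
rewrite [X in _ + X](eq_bigr (fun u => \sum_v (if enum_rank u < enum_rank v
  then f u v else 0))).
  rewrite [X in _ + X]exchange_big -big_split/=; apply: eq_bigr => u _.
  rewrite big_mkcond -big_split/=; apply: eq_bigr => v _.
  have [uv|vu|/val_inj/enum_rank_inj ->] := ltngtP (enum_rank u) (enum_rank v).
  - by rewrite addn0.
  - by rewrite add0n fC.
  - by rewrite f0.
by move=> u _; rewrite big_mkcond.
Qed.

(* The graph distance in the 5-cycle. *)
Definition c5 i j := minn ((i + (5 - j)) %% 5) ((j + (5 - i)) %% 5).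

Definition adj5 i j := (j == i.+1 %% 5) || (i == j.+1 %% 5).

Ltac case5 i := case: i => [|[|[|[|[|i]]]]] //.

Lemma c5C i j : c5 i j = c5 j i.
Proof. by rewrite /c5 minnC. Qed.

Lemma c5_eq0 i j : i < 5 -> j < 5 -> (c5 i j == 0) = (i == j).
Proof. by case5 i; case5 j. Qed.

Lemma c5nn i : i < 5 -> c5 i i = 0.
Proof. by case5 i. Qed.

Lemma c5_le2 i j : i < 5 -> j < 5 -> c5 i j <= 2.
Proof. by case5 i; case5 j. Qed.

Lemma c5_adj i j k : i < 5 -> j < 5 -> k < 5 -> adj5 j k -> c5 k i <= (c5 j i).+1.
Proof. by case5 i; case5 j; case5 k. Qed.

Lemma c5_pred i j d : i < 5 -> j < 5 -> c5 j i = d.+1 ->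
  exists k, [/\ k < 5, adj5 k j & c5 k i = d].
Proof.
move=> i5 j5 E.
have : has (fun k => adj5 k j && (c5 k i == (c5 j i).-1)) (iota 0 5).
  by move: i5 j5 E; case5 i; case5 j.
by case/hasP => k; rewrite mem_iota E => k5 /andP[kj /eqP]; exists k.
Qed.

(* Here t is the attachment vertex of the next pentagon; a and b tell whether a next and a previous pentagon exist *)
Definition deg5 (a b : bool) t i : nat := 2 + (a && (i == t)) + (b && (i == 0)).

Lemma sum_deg5 a b t : t < 5 -> \sum_(i < 5) deg5 a b t i = 10 + a + b.
Proof. by rewrite !big_ord_recl big_ord0; case: a; case: b; case5 t. Qed.

(** The base degrees give [2 * (0 + 1 + 1 + 2 + 2) = 12]; the extra degree at vertex 0 sits at
    distance 0. *)
Lemma sum_deg5_c5_first a b t : t < 5 ->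
  \sum_(i < 5) deg5 a b t i * c5 i 0 = 12 + a * c5 t 0.
Proof. by rewrite !big_ord_recl big_ord0; case: a; case: b; case5 t. Qed.

Lemma sum_deg5_c5_att a b t : t < 5 ->
  \sum_(i < 5) deg5 a b t i * c5 i t = 12 + b * c5 t 0.
Proof. by rewrite !big_ord_recl big_ord0; case: a; case: b; case5 t. Qed.

(** The base degrees give [4 * 30], each extra degree against the base degrees gives [2 * 2 * 6],
    and the two extra degrees meet in both orders. *)
Lemma sum_deg5_deg5_c5 a b t : t < 5 ->
  \sum_(i < 5) \sum_(j < 5) deg5 a b t i * deg5 a b t j * c5 j i
    = 120 + 24 * (a + b) + 2 * (a * b * c5 t 0).
Proof. by rewrite !big_ord_recl !big_ord0; case: a; case: b; case5 t. Qed.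

Section pentagonal_chain.
Variables (n : nat) (u1 : 'I_5) (sel z : nat -> bool).
Local Notation att := (pg_att u1 sel z).
Local Notation adj := (pg_adj n u1 sel z).

Definition delta k := c5 (att k) 0.

Lemma att_lt5 k : att k < 5.
Proof.
rewrite /pg_att; case: (k == 0); first exact: (ltn_ord u1).
by case: (z k.+1); case: (sel k.+1).
Qed.

(** Pentagon 0 is excluded because its attachment vertex [u1] is arbitrary. Pentagons count from 0
    and the choices from 1, hence the shift. *)
Lemma deltaE k : 0 < k -> delta k = if z k.+1 then 1 else 2.
Proof.
case: k => [//|k] _; rewrite /delta /pg_att /=.
by case: (z k.+2); case: (sel k.+2).
Qed.

(* Distance from the linking vertex of pentagon k to the first vertex of
   pentagon l, for k < l. *)
Definition between k l := (l - k) + \sum_(k.+1 <= m < l) delta m.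

Lemma between_recr k l : k < l -> between k l.+1 = (between k l + delta l).+1.
Proof. by move=> kl; rewrite /between big_nat_recr//= subSn 1?ltnW//; lia. Qed.

Lemma between_recl k l : k.+1 < l -> between k l = (between k.+1 l + delta k.+1).+1.
Proof. by move=> kl; rewrite /between big_ltn//; lia. Qed.

Lemma between_succ k : between k k.+1 = 1.
Proof. by rewrite /between big_geq// subSnn addn0. Qed.

Lemma between_le k l : k < l -> between k l <= (l - k) + 2 * (l - k.+1).
Proof.
move=> kl; rewrite leq_add2l mulnC -sum_nat_const_nat leq_sum// => m _.
by rewrite c5_le2 ?att_lt5.
Qed.

(* A shortest path from vertex i of pentagon k enters pentagon l through its
   vertex gate k i l, after base k i l steps. *)
Definition gate k i l := if k == l then i else if k < l then 0 else att l.
Definition base k i l :=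
  if k == l then 0 else if k < l then c5 i (att k) + between k l
  else c5 i 0 + between l k.

Definition pg_dist (u v : 'I_n * 'I_5) : nat :=
  c5 v.2 (gate u.1 u.2 v.1) + base u.1 u.2 v.1.

Lemma gate_lt5 k i l : i < 5 -> gate k i l < 5.
Proof. by rewrite /gate; case: ifP => // _; case: ifP => // _; rewrite att_lt5. Qed.

Lemma pg_distC u v : pg_dist u v = pg_dist v u.
Proof.
rewrite /pg_dist /gate /base; case: ltngtP => [uv|uv|_].
- by rewrite !addnA [c5 v.2 0 + _]addnC.
- by rewrite !addnA [c5 v.2 _ + _]addnC.
- by rewrite !addn0 c5C.
Qed.

Lemma pg_dist0 u v : pg_dist u v = 0 <-> u = v.
Proof.
rewrite /pg_dist /gate /base; split => [|->]; last by rewrite eqxx addn0 c5nn.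
case: ltngtP => [uv|uv|uv] /eqP; rewrite addn_eq0.
- by rewrite addn_eq0 /between; lia.
- by rewrite addn_eq0 /between; lia.
- rewrite andbT c5_eq0// => /eqP vu; case: u v uv vu => [u1' u2'] [v1 v2] /= a b.
  by congr pair; apply: val_inj.
Qed.

(** The link is a bridge, so the side on which [u] lies decides which end is farther. Both the edge
    bound and the existence of predecessors use this. *)
Lemma pg_dist_link (u x y : 'I_n * 'I_5) :
  y.1 = x.1.+1 :> nat -> x.2 = att x.1 :> nat -> y.2 = 0 :> nat ->
  if u.1 <= x.1 then pg_dist u y = (pg_dist u x).+1
  else pg_dist u x = (pg_dist u y).+1.
Proof.
move=> E1 E2 E3; rewrite /pg_dist E1 E2 E3 /gate /base.
case: (ltngtP u.1 x.1) => [ux|xu|->].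
- have ux1 : u.1 < x.1.+1 by rewrite leqW.
  by rewrite ux1 (ltn_eqF ux1) between_recr// c5nn// /delta; lia.
- rewrite c5nn ?att_lt5//; case: (ltngtP u.1 x.1.+1) => [ux|xu1|->]; first by lia.
    by rewrite between_recl// /delta [c5 0 _]c5C; lia.
  by rewrite between_succ addn0 [c5 0 _]c5C; lia.
- by rewrite ltnSn (ltn_eqF (ltnSn _)) between_succ c5nn// [c5 (att _) _]c5C; lia.
Qed.

Lemma pg_adj_cases (x y : 'I_n * 'I_5) : adj x y ->
  [\/ x.1 = y.1 /\ adj5 x.2 y.2,
      [/\ y.1 = x.1.+1 :> nat, x.2 = att x.1 :> nat & y.2 = 0 :> nat]
    | [/\ x.1 = y.1.+1 :> nat, y.2 = att y.1 :> nat & x.2 = 0 :> nat]].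
Proof.
by case/or3P => [/andP[/eqP ? ?]|/and3P[/eqP ? /eqP ? /eqP ?]|/and3P[/eqP ?
  /eqP ? /eqP ?]];
  [constructor 1|constructor 2|constructor 3].
Qed.

Lemma pg_dist_edge u x y : adj x y -> pg_dist u y <= (pg_dist u x).+1.
Proof.
case/pg_adj_cases => [[xy a]|[E1 E2 E3]|[E1 E2 E3]].
- by rewrite /pg_dist xy -addSn leq_add2r c5_adj// gate_lt5.
- by have := pg_dist_link u E1 E2 E3; case: ifP => _ ->//; rewrite leqW// leqnSn.
- by have := pg_dist_link u E1 E2 E3; case: ifP => _ ->//; rewrite leqW// leqnSn.
Qed.

Lemma pg_dist_pred u v k : pg_dist u v = k.+1 -> exists2 x, pg_dist u x = k & adj x v.
Proof.
move=> E.
(* If [v] is the gate of its pentagon, the predecessor lies across the link towards [u]; otherwise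
   it lies one step along the cycle towards the gate. *)
case E0 : (c5 v.2 (gate u.1 u.2 v.1)) => [|d].
  have vg : v.2 = gate u.1 u.2 v.1 :> nat.
    by apply/eqP; rewrite -c5_eq0 ?gate_lt5// E0.
  case: (ltngtP u.1 v.1) => uv.
  - have v1n : v.1.-1 < n by rewrite (leq_ltn_trans (leq_pred _)).
    pose x : 'I_n * 'I_5 := (Ordinal v1n, Ordinal (att_lt5 v.1.-1)).
    have E1 : v.1 = x.1.+1 :> nat by rewrite /= prednK//; lia.
    have v0 : v.2 = 0 :> nat by rewrite vg /gate uv ltn_eqF.
    exists x; last by apply/or3P; constructor 2; apply/and3P; split; apply/eqP.
    have := pg_dist_link u E1 (erefl : x.2 = att x.1 :> nat) v0.
    by rewrite E /=; case: ifP => [_ []//|]; lia.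
  - have v1n : v.1.+1 < n by rewrite (leq_trans _ (ltn_ord u.1)).
    pose x : 'I_n * 'I_5 := (Ordinal v1n, ord0).
    have va : v.2 = att v.1 :> nat by rewrite vg /gate gtn_eqF// ltnNge ltnW.
    exists x; last by apply/or3P; constructor 3; apply/and3P; split; apply/eqP.
    have := pg_dist_link u (erefl : x.1 = v.1.+1 :> nat) va (erefl : x.2 = 0 :> nat).
    by rewrite E /=; case: ifP => [|_ []//]; lia.
  - by move: E; rewrite /pg_dist E0 /base uv eqxx.
have [j [j5 jv jd]] := c5_pred (gate_lt5 u.1 v.1 (ltn_ord u.2)) (ltn_ord v.2) E0.
exists (v.1, Ordinal j5); last by apply/or3P; constructor 1; rewrite eqxx.
by move: E; rewrite /pg_dist E0 /= jd addSn => -[].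
Qed.

(** Each end costs at most 2, each link 1 and each crossed pentagon at most 2, so a distance is at
    most [3 * n - 1], below the [5 * n] vertices. *)
Lemma pg_dist_lt u v : pg_dist u v < #|{: 'I_n * 'I_5}|.
Proof.
rewrite card_prod !card_ord /pg_dist /gate /base.
have u2 := c5_le2 (ltn_ord u.2) (att_lt5 u.1).
have u0 := c5_le2 (ltn_ord u.2) (isT : 0 < 5).
have v2 := c5_le2 (ltn_ord v.2) (att_lt5 v.1).
have v0 := c5_le2 (ltn_ord v.2) (isT : 0 < 5).
have uv0 := c5_le2 (ltn_ord v.2) (ltn_ord u.2).
have un := ltn_ord u.1; have vn := ltn_ord v.1.
by case: (ltngtP u.1 v.1) => [/between_le|/between_le|_]; lia.
Qed.

Lemma gdist_pg u v : gdist adj u v = pg_dist u v.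
Proof.
apply: gdistE; [exact: pg_dist0|exact: pg_dist_edge|exact: pg_dist_pred|].
exact: pg_dist_lt.
Qed.

Lemma sum_ord_eq m k : \sum_(l < m) ((l : nat) == k : nat) = (k < m).
Proof.
have [km|mk] := ltnP k m.
  rewrite (bigD1 (Ordinal km))//= eqxx big1// => l lk.
  by apply/eqP; rewrite eqb0; apply: contra lk => /eqP lk; apply/eqP/val_inj.
by rewrite big1// => l _; apply/eqP; rewrite eqb0 ltn_eqF// (leq_trans (ltn_ord l)).
Qed.

Definition pg_deg k i := deg5 (k.+1 < n) (0 < k) (att k) i.

(** Turns the adjacency test into a sum, so that neighbours in the same, next and previous pentagon
    are counted separately. *)
Lemma nat_of_disjoint_or (p a b c d b' c' d' : bool) : p + b + b' <= 1 ->
  (if [|| p && a, [&& b, c & d] | [&& b', c' & d']] then 1 else 0)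
  = p * a + (b && c) * d + (b' && d') * c'.
Proof. by case: p a b c d b' c' d' => [] [] [] [] [] [] [] []. Qed.

Lemma gdeg_pg (u : 'I_n * 'I_5) : gdeg adj u = pg_deg u.1 u.2.
Proof.
case: u => k i; rewrite /gdeg -sum1dep_card big_mkcond /=.
rewrite -(pair_bigA _ (fun l j => if adj (k, i) (l, j) then 1 else 0))/=.
rewrite (eq_bigr (fun l : 'I_n => \sum_(j < 5) ((l == k :> nat) * adj5 i j
   + ((l == k.+1 :> nat) && (i == att k :> nat)) * (j == 0 :> nat)
   + ((l == k.-1 :> nat) && (0 < k) && (i == 0 :> nat)) * (j == att l :>
     nat)))); last first.
  move=> l _; apply: eq_bigr => j _; rewrite /pg_adj -/(adj5 i j) /=.
  have -> : (k == l) = (l == k :> nat) by rewrite eq_sym.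
  (* Since [0.-1 = 0], the guard [0 < k] is what denies the first pentagon a predecessor. *)
  have -> : (k == l.+1 :> nat) = (l == k.-1 :> nat) && (0 < k) by lia.
  by apply: nat_of_disjoint_or; lia.
rewrite (eq_bigr (fun l : 'I_n => (l == k :> nat) * 2
   + (l == k.+1 :> nat) * (i == att k :> nat)
   + (l == k.-1 :> nat) * ((0 < k) && (i == 0 :> nat)))); last first.
  move=> l _; rewrite !big_split/= -!big_distrr/= !sum_ord_eq att_lt5 !muln1
    -!mulnb -!mulnA.
  congr (_ * _ + _ + _).
  by rewrite !big_ord_recl big_ord0; case: i => i /=; case5 i.
rewrite !big_split/= -!big_distrl/= !sum_ord_eq ltn_ord mul1n mulnb /pg_deg /deg5.
have -> : k.-1 < n by rewrite (leq_ltn_trans (leq_pred _)).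
by rewrite mul1n.
Qed.

End pentagonal_chain.

(** * The Gutman index as an affine function of the choices *)

Section gutman_chain.
Variables (n : nat) (u1 : 'I_5).

Definition weight k : nat := 10 + (k.+1 < n) + (0 < k).

(* Contribution to the coefficient of [delta m] of the part of the pair lying
   in pentagon k: full weight when strictly on one side of pentagon m, and only
   the extra degree of the linking vertex when k = m *)
Definition wleft k m := if k < m then weight k else (k == m).
Definition wright l m := if m < l then weight l else (l == m).

(** An end pentagon is never crossed and has at most one linking vertex, so its [delta m] has
    coefficient zero. *)
Definition inner m := (0 < m) && (m.+1 < n).

Definition pair_const k l :=
  if k == l then 120 + 24 * ((k.+1 < n) + (0 < k))
  else 12 * weight k + 12 * weight l + weight k * weight l * (maxn k l - minn k l).

(** The first pentagon counts 11, those between it and [m] count 12 each, and pentagon [m] itself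
    supplies the missing 1. *)
Lemma sum_wleft m : inner m -> \sum_(k < n) wleft k m = 12 * m.
Proof.
case/andP => m0 mn.
rewrite -(big_mkord xpredT (wleft^~ m)) (big_cat_nat (n := m))//=; last by lia.
rewrite [X in _ + X]big_ltn; last by lia.
rewrite [X in _ + (_ + X)]big1_seq; last first.
  by move=> k /=; rewrite mem_index_iota /wleft => /andP[mk _]; case: ltngtP; lia.
rewrite {2}/wleft ltnn eqxx addn0 big_ltn// {1}/wleft m0.
rewrite (eq_big_nat _ _ (F2 := fun=> 12)); last first.
  by move=> k /andP[k0 km]; rewrite /wleft km /weight; lia.
by rewrite sum_nat_const_nat /weight; lia.
Qed.

Lemma sum_wright m : inner m -> \sum_(l < n) wright l m = 12 * (n.-1 - m).
Proof.
case/andP => m0 mn.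
rewrite -(big_mkord xpredT (wright^~ m)) (big_cat_nat (n := m))//=; last by lia.
rewrite [X in X + _]big1_seq; last first.
  by move=> k /=; rewrite mem_index_iota /wright => /andP[_ km]; case: ltngtP km; lia.
rewrite big_ltn; last by lia.
rewrite {1}/wright ltnn eqxx add0n.
have [n' nE] : exists n', n = n'.+1 by exists n.-1; lia.
rewrite {1}nE big_nat_recr/=; last by lia.
rewrite (eq_big_nat _ _ (F2 := fun=> 12)); last first.
  by move=> l /andP[ml ln]; rewrite /wright ml /weight; lia.
have -> : wright n' m = 11 by rewrite /wright /weight; case: ifP; lia.
by rewrite sum_nat_const_nat; lia.
Qed.

Section config.
Variables (sel z : nat -> bool).
Local Notation att := (pg_att u1 sel z).
Local Notation delta := (delta u1 sel z).
Local Notation deg := (pg_deg n u1 sel z).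

Definition pair_sum (k l : 'I_n) :=
  \sum_(i < 5) \sum_(j < 5) deg k i * deg l j * pg_dist u1 sel z (k, i) (l, j).

Lemma pair_sumC k l : pair_sum k l = pair_sum l k.
Proof.
rewrite /pair_sum exchange_big; apply: eq_bigr => j _; apply: eq_bigr => i _.
by rewrite pg_distC [deg k i * _]mulnC.
Qed.

Lemma sum_pg_deg k : k < n -> \sum_(i < 5) deg k i = weight k.
Proof. by move=> kn; rewrite sum_deg5 ?att_lt5. Qed.

Lemma pair_sum_lt (k l : 'I_n) : k < l ->
  pair_sum k l = pair_const k l
    + \sum_(m < n | inner m) delta m * (wleft k m * wright l m).
Proof.
move=> kl; have ln := ltn_ord l.
(* Pentagons outside [[k, l]] contribute nothing, those strictly inside are crossed in full, and [k]
   and [l] enter only through the extra degree at their far link. *)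
have -> : \sum_(m < n | inner m) delta m * (wleft k m * wright l m) =
   (0 < k) * delta k * weight l + (l.+1 < n) * delta l * weight k
   + weight k * weight l * \sum_(k.+1 <= m < l) delta m.
  rewrite big_mkcond/=.
  rewrite -(big_mkord xpredT (fun m => if inner m then delta m * (wleft k m *
    wright l m) else 0)).
  rewrite (big_cat_nat (n := k))//=; last by lia.
  rewrite [X in X + _]big1_seq ?add0n; last first.
    move=> m /=; rewrite mem_index_iota => /andP[_ mk].
    by rewrite /wleft ltnNge ltnW//= gtn_eqF// mul0n muln0; case: ifP.
  rewrite big_ltn; last by lia.
  rewrite (big_cat_nat (n := l))//=; last by lia.
  rewrite [X in _ + (_ + X)]big_ltn//.
  rewrite [X in _ + (_ + (_ + X))]big1_seq ?addn0; last first.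
    move=> m /=; rewrite mem_index_iota => /andP[lm _].
    by rewrite /wright ltnNge ltnW//= ltn_eqF// muln0 muln0; case: ifP.
  have -> : wleft k k = 1 by rewrite /wleft ltnn eqxx.
  have -> : wright l k = weight l by rewrite /wright kl.
  have -> : wleft k l = weight k by rewrite /wleft kl.
  have -> : wright l l = 1 by rewrite /wright ltnn eqxx.
  rewrite big_distrr/= (eq_big_nat _ _ (F2 := fun m => weight k * weight l *
    delta m)); last first.
    move=> m /andP[km ml].
    by rewrite /inner /wleft /wright km ml ifT ?mulnA 1?mulnC ?mulnA//; lia.
  have -> : inner k = (0 < k) by rewrite /inner; lia.
  have -> : inner l = (l.+1 < n) by rewrite /inner; lia.
  by case: (0 < k); case: (l.+1 < n); rewrite ?mul1n ?mul0n; lia.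
(* The distance splits at the links into a part depending on [i], a part depending on [j] and the
   constant [between], so the double sum factorises. *)
have -> : pair_sum k l = weight k * (\sum_(j < 5) deg l j * c5 j 0)
    + (\sum_(i < 5) deg k i * c5 i (att k)) * weight l
    + weight k * weight l * between u1 sel z k l.
  rewrite -!(sum_pg_deg (ltn_ord _)) /pair_sum.
  rewrite !big_distrl/= -!big_split/=; apply: eq_bigr => i _.
  rewrite !big_distrr/= !big_distrl -!big_split/=; apply: eq_bigr => j _.
  rewrite /pg_dist /gate /base/= kl ltn_eqF//; lia.
rewrite sum_deg5_c5_first ?att_lt5// sum_deg5_c5_att ?att_lt5//.
rewrite /between /pair_const ltn_eqF// (maxn_idPr (ltnW kl)) (minn_idPl (ltnW kl)).
rewrite -/(delta k) -/(delta l); lia.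
Qed.

(** Only the two extra degrees, at the linking vertices, involve [delta k]; ordered pairs count them
    twice. *)
Lemma pair_sum_diag (k : 'I_n) :
  pair_sum k k = pair_const k k
    + \sum_(m < n | inner m) delta m * (2 * (wleft k m * wright k m)).
Proof.
have -> : \sum_(m < n | inner m) delta m * (2 * (wleft k m * wright k m))
   = inner k * (2 * delta k).
  rewrite big_mkcond (bigD1 k)//= big1 ?addn0; last first.
    move=> m mk; have {}mk : m != k :> nat by [].
    rewrite /wleft /wright; case: ltngtP mk => //= _ _; rewrite ?mul0n ?muln0;
      by case: ifP.
  by rewrite /wleft /wright ltnn eqxx muln1; case: (inner k); lia.
rewrite /pair_sum (eq_bigr (fun i : 'I_5 => \sum_(j < 5) deg k i * deg k j * c5
  j i)); last first.
  move=> i _; apply: eq_bigr => j _.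
  by rewrite /pg_dist /gate /base eqxx /= addn0.
rewrite sum_deg5_deg5_c5 ?att_lt5// /pair_const eqxx -/(delta k) /inner.
by rewrite andbC -mulnb; lia.
Qed.

(** Off the diagonal one of the two products is zero; on it they coincide. This symmetric form can
    be summed over all ordered pairs. *)
Lemma pair_sumE (k l : 'I_n) :
  pair_sum k l = pair_const k l + \sum_(m < n | inner m)
    delta m * (wleft k m * wright l m + wleft l m * wright k m).
Proof.
have wl0 k' l' m : k' < l' -> wleft l' m * wright k' m = 0.
  by move=> kl; rewrite /wleft /wright; case: (ltngtP l' m); case: (ltngtP k'
    m); rewrite ?muln0 ?mul0n//; lia.
case: (ltngtP k l) => [kl|lk|/val_inj <-].
- by rewrite pair_sum_lt//; congr (_ + _); apply: eq_bigr => m _; rewrite (wl0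
  k l)// addn0.
- rewrite pair_sumC pair_sum_lt//; congr (_ + _).
    by rewrite /pair_const (ltn_eqF lk) (gtn_eqF lk) maxnC minnC; lia.
  by apply: eq_bigr => m _; rewrite (wl0 l k).
- by rewrite pair_sum_diag; congr (_ + _); apply: eq_bigr => m _; rewrite mul2n addnn.
Qed.

Lemma gut_PG_double :
  (gut_PG n u1 sel z).*2 = \sum_(k < n) \sum_(l < n) pair_const k l
    + (\sum_(m < n | inner m) delta m * (144 * m * (n.-1 - m))).*2.
Proof.
rewrite /gut_PG /gutman.
rewrite (sum_unordered (f := fun u v => gdeg (pg_adj n u1 sel z) u * gdeg
  (pg_adj n u1 sel z) v * gdist (pg_adj n u1 sel z) u v)); first last.
- by move=> u v; rewrite !gdist_pg pg_distC [gdeg _ u * _]mulnC.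
- by move=> u; rewrite gdist_pg (pg_dist0 _ _ _ u u).2 ?muln0.
transitivity (\sum_(k < n) \sum_(l < n) pair_sum k l).
  pose F (k : 'I_n) (i : 'I_5) (l : 'I_n) (j : 'I_5) := deg k i * deg l j *
    pg_dist u1 sel z (k, i) (l, j).
  rewrite (eq_bigr (fun u => \sum_v F u.1 u.2 v.1 v.2)); last first.
    by move=> [k i] _; apply: eq_bigr => -[l j] _; rewrite !gdeg_pg gdist_pg.
  rewrite -(pair_bigA _ (fun k i => \sum_v F k i v.1 v.2))/=.
  apply: eq_bigr => k _; rewrite /pair_sum [RHS]exchange_big/=; apply: eq_bigr => i _.
  by rewrite -(pair_bigA _ (fun l j => F k i l j)).
under eq_bigr => k _ do (under eq_bigr => l _ do rewrite pair_sumE; rewrite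
  big_split/=).
rewrite big_split/=; congr (_ + _).
(* With [m] outermost, the coefficient of [delta m] factorises into the side sums of [wleft] and
   [wright], the product occurring twice. *)
under eq_bigr => k _ do rewrite exchange_big/=.
rewrite exchange_big/= -addnn -big_split/=; apply: eq_bigr => m im.
under eq_bigr => k _ do rewrite -big_distrr/=.
rewrite -big_distrr/= -mulnDr; congr (_ * _).
under eq_bigr => k _ do rewrite big_split/= -big_distrl -big_distrr/=.
rewrite big_split/= -big_distrl -big_distrr/= !sum_wleft// !sum_wright//.
lia.
Qed.

End config.

(** [C] is fixed before [z]: all randomness sits in the sum. *)
Lemma gut_PG_affine (sel : nat -> bool) : exists C, forall z : nat -> bool,
  gut_PG n u1 sel z = C + \sum_(m < n | inner m)
    (if z m.+1 then 1 else 2) * (144 * m * (n.-1 - m)).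
Proof.
exists (\sum_(k < n) \sum_(l < n) pair_const k l)./2 => z.
rewrite -[LHS]doubleK gut_PG_double halfD odd_double andbF add0n doubleK.
congr (_ + _); apply: eq_bigr => m /andP[m0 _].
by rewrite (deltaE _ _ _ m0).
Qed.

End gutman_chain.

Local Open Scope ring_scope.
Local Open Scope classical_set_scope.

(** * The normal distribution function *)

Section normal.
Context {R : realType}.
Implicit Types a b c s t x y z : R.

Definition phi t : R := (Num.sqrt (2 * pi))^-1 * expR (- (t ^+ 2) / 2).

Lemma phiE : phi = normal_pdf 0 1.
Proof.
apply/funext => t; rewrite normal_pdfE ?oner_neq0// /phi /normal_peak /normal_fun.
by rewrite !expr1n !mul1r subr0 (mulr_natl pi 2).
Qed.

(** Gives access to general facts on probability measures: bounds, monotonicity and tails. *)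
Lemma Phi_prob x : (std_normal_cdf x)%:E = normal_prob 0 1 `]-oo, x]%classic.
Proof.
have E : normal_prob 0 1 `]-oo, x]%classic =
   (\int[@lebesgue_measure R]_(t in [set t : R | (t <= x)%R]) (phi t)%:E)%E.
  by rewrite /normal_prob phiE; congr (integral _ _ _); rewrite set_itvE.
rewrite /std_normal_cdf -[X in fine X]/(\int[@lebesgue_measure R]_(t in [set t
  : R | (t <= x)%R]) (phi t)%:E)%E.
by rewrite -E fineK// fin_num_measure.
Qed.

Lemma Phi_ge0 x : 0 <= std_normal_cdf x.
Proof. by rewrite -lee_fin Phi_prob. Qed.

Lemma Phi_le1 x : std_normal_cdf x <= 1.
Proof. by rewrite -lee_fin Phi_prob probability_le1. Qed.

Lemma Phi_mono x y : x <= y -> std_normal_cdf x <= std_normal_cdf y.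
Proof.
move=> xy; rewrite -lee_fin !Phi_prob le_measure ?inE//.
exact: subset_itvl.
Qed.

Let idTR : measurableTypeR R -> R := idfun.

#[local] HB.instance Definition _ :=
  @isMeasurableFun.Build _ _ _ _ idTR (@measurable_id _ _ setT).

Lemma Phi_tails (e : R) : 0 < e ->
  exists2 M, 0 < M & std_normal_cdf (- M) <= e /\ 1 - e <= std_normal_cdf M.
Proof.
move=> e0.
pose X : {RV (normal_prob (0:R) 1) >-> R} := idTR.
have cE r : cdf X r = (std_normal_cdf r)%:E by rewrite Phi_prob.
have Hy : std_normal_cdf x @[x --> +oo] --> (1:R).
  have := cvg_cdfy1 X.
  rewrite (_ : cdf X = EFin \o std_normal_cdf) 1?cvg_EFin//; last exact/funext.
  by move/fine_cvg.
have Hn : std_normal_cdf x @[x --> -oo] --> (0:R).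
  have := cvg_cdfNy0 X.
  rewrite (_ : cdf X = EFin \o std_normal_cdf) //; last exact/funext.
  by move/fine_cvg.
have [A [Ar HA]] : exists M, M \is Num.real /\ forall x, M < x -> 1 - e <=
  std_normal_cdf x.
  move/cvgrPdist_le : Hy => /(_ e e0)[M [Mr HM]]; exists M; split=> // x /HM.
  by rewrite ler_norml => /andP[_]; lra.
have [B [Br HB]] : exists M, M \is Num.real /\ forall x, x < M ->
  std_normal_cdf x <= e.
  move/cvgrPdist_le : Hn => /(_ e e0)[M [Mr HM]]; exists M; split=> // x /HM.
  by rewrite ler_norml => /andP[+ _]; lra.
(* One symmetric threshold beyond both [A] and [B]; the [1] makes the inequalities strict. *)
exists (`|A| + `|B| + 1); first by have := normr_ge0 A; have := normr_ge0 B; lra.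
split; [apply: HB|apply: HA].
  have := ler_norm (- B); rewrite normrN; have := normr_ge0 A; lra.
have := ler_norm A; have := normr_ge0 B; lra.
Qed.

Lemma is_derive_Phi x : is_derive x 1 (@std_normal_cdf R) (phi x).
Proof.
have int : (@lebesgue_measure R).-integrable [set: R] (EFin \o phi).
  by rewrite phiE; exact: integrable_normal_pdf.
have cphi : continuous phi by rewrite phiE; apply: continuous_normal_pdf;
  rewrite oner_neq0.
have xx1 : x < x + 1 by rewrite ltrDl.
have intx : (@lebesgue_measure R).-integrable `]-oo, x + 1]%classic (EFin \o phi).
  exact: integrableS int.
have [D E] := continuous_FTC1 xx1 intx (ltNyr x) (cphi x).
have -> : @std_normal_cdf R = (fun y => \int[lebesgue_measure]_(t in [set`
  `]-oo, y]]) (phi t))%R.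
  by apply/funext => y; rewrite /std_normal_cdf /Rintegral; congr (fine
    (integral _ _ _)); rewrite set_itvE.
by apply: DeriveDef; [exact: D|rewrite -derive1E E].
Qed.

End normal.

(** * Derivative rules and bounds for the Gaussian density *)

Section deriv.
Context {R : realType}.
Implicit Types (f g : R -> R) (a b c s t x y z : R).

Lemma derive_lipschitz f df K a b : a <= b ->
  (forall x, a <= x <= b -> is_derive x 1 f (df x)) ->
  (forall x, a <= x <= b -> `|df x| <= K) -> `|f b - f a| <= K * (b - a).
Proof.
move=> ab D B.
have [x| |c] := MVT_segment ab (f := f) (df := df).
- by rewrite in_itv/= => /andP[/ltW ax /ltW xb]; apply: D; rewrite ax.
- apply: derivable_within_continuous => x; rewrite in_itv/= => xab.
  by have [] := D x xab.
- rewrite in_itv/= => cab ->.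
  by rewrite normrM (ger0_norm (x := b - a)) ?subr_ge0// ler_wpM2r ?subr_ge0// B.
Qed.

Lemma is_derive_val a f x b : is_derive x 1 f a -> a = b -> is_derive x 1 f b.
Proof. by move=> ? <-. Qed.

Lemma is_derive_add f g x a b : is_derive x 1 f a -> is_derive x 1 g b ->
  is_derive x 1 (fun y => f y + g y) (a + b).
Proof. by move=> ? ?; exact: is_deriveD. Qed.

Lemma is_derive_sub f g x a b : is_derive x 1 f a -> is_derive x 1 g b ->
  is_derive x 1 (fun y => f y - g y) (a - b).
Proof. by move=> ? ?; exact: is_deriveB. Qed.

Lemma is_derive_mul f g x a b : is_derive x 1 f a -> is_derive x 1 g b ->
  is_derive x 1 (fun y => f y * g y) (f x * b + g x * a).
Proof. by move=> ? ?; exact: is_deriveM. Qed.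

Lemma is_derive_scale k f x a : is_derive x 1 f a ->
  is_derive x 1 (fun y => k * f y) (k * a).
Proof. by move=> ?; exact: is_deriveZ. Qed.

Lemma is_derive_compose f g x a b : is_derive (g x) 1 f a -> is_derive x 1 g b ->
  is_derive x 1 (fun y => f (g y)) (a * b).
Proof. by move=> ? ?; exact: is_derive1_comp. Qed.

Lemma is_derive_affine a b x : is_derive x 1 (fun y => a + y * b) b.
Proof.
apply: (is_derive_val (a := 0 + b * 1)); last by rewrite add0r mulr1.
apply: is_derive_add.
rewrite (_ : (fun y => y * b) = (fun y => b * y)); last by apply/funext => y;
  rewrite mulrC.
apply: is_derive_scale.
Qed.

Lemma is_derive_phi x : is_derive x 1 phi (- (x * phi x)).
Proof.
rewrite /phi.
apply: (is_derive_val (a := (Num.sqrt (2 * pi))^-1 * (expR (- (x ^+ 2) / 2) *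
  (- x)))); last by ring.
apply: is_derive_scale; apply: is_derive_compose.
rewrite (_ : (fun y : R => - (y ^+ 2) / 2) = (fun y => (- 2^-1) * (y * y)));
  last first.
  by apply/funext => y; rewrite expr2 mulrC mulrN mulNr.
apply: (is_derive_val (a := - 2^-1 * (x * 1 + x * 1))); last by field.
Qed.

Lemma phi_ge0 x : 0 <= phi x.
Proof. by rewrite /phi mulr_ge0 ?invr_ge0 ?expR_ge0. Qed.

(** [|z| ^+ k <= 1 + z ^+ 4] for [k <= 4], while [expR u >= 1 + u ^+ 2 / 2] at [u = z ^+ 2 / 2]
    gives [1 + z ^+ 4 / 8]; a factor 9 suffices. *)
Lemma powM_phi_le k z : (k <= 4)%N -> `|z| ^+ k * phi z <= 9.
Proof.
move=> k4.
have c1 : (Num.sqrt (2 * pi))^-1 <= 1 :> R.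
  rewrite invf_le1 ?sqrtr_gt0; last by rewrite mulr_gt0// pi_gt0.
  rewrite -[leLHS]sqrtr1 ler_wsqrtr//.
  have := @pi_ge2 R; lra.
have le : `|z| ^+ k <= 1 + z ^+ 4.
  have z0 := normr_ge0 z.
  have -> : z ^+ 4 = `|z| ^+ 4 by rewrite -normrX ger0_norm// exprn_even_ge0.
  case: (leP `|z| 1) => z1.
    by rewrite (le_trans (exprn_ile1 _ z0 z1))// lerDl exprn_ge0.
  by rewrite (le_trans (ler_weXn2l (ltW z1) k4))// lerDr.
have E : 1 + z ^+ 4 <= 9 * expR (z ^+ 2 / 2).
  have u0 : 0 <= z ^+ 2 / 2 by rewrite divr_ge0// sqr_ge0.
  have := expR_ge1Dxn 1 u0.
  rewrite (_ : 2`!%:R = 2 :> R)// (_ : (z ^+ 2 / 2) ^+ 2 / 2 = z ^+ 4 / 8);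
    last by field.
  by have : 0 <= z ^+ 4; [rewrite exprn_even_ge0|lra].
rewrite /phi mulNr expRN mulrCA.
apply: (@le_trans _ _ (1 * (`|z| ^+ k / expR (z ^+ 2 / 2)))).
  by rewrite ler_wpM2r// divr_ge0 ?exprn_ge0 ?expR_ge0.
by rewrite mul1r ler_pdivrMr ?expR_gt0// (le_trans le).
Qed.

Lemma Phi_lipschitz a b : a <= b ->
  `|std_normal_cdf b - std_normal_cdf a| <= 9 * (b - a).
Proof.
move=> ab; apply: (derive_lipschitz (df := phi)) => // x _.
  exact: is_derive_Phi.
by rewrite ger0_norm ?phi_ge0//; have := @powM_phi_le 0 x isT; rewrite mul1r.
Qed.

(* Minus the y-derivative of the centred Gaussian density of standard deviation
   s; by the heat equation, also -2 times the derivative of Phi (y / s) in s^2. *)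
Definition psi s y : R := s ^- 2 * (y / s * phi (y / s)).

Lemma is_derive_density s y : s != 0 ->
  is_derive y 1 (fun y => s^-1 * phi (y / s)) (- psi s y).
Proof.
move=> s0.
apply: (is_derive_val (a := s^-1 * (- (y / s * phi (y / s)) * s^-1))); last first.
  by rewrite /psi; field.
apply: is_derive_scale; apply: (is_derive_compose (is_derive_phi _)).
rewrite (_ : (fun y => y / s) = (fun y => 0 + y * s^-1)); last by apply/funext
  => z; rewrite add0r.
exact: is_derive_affine.
Qed.

Lemma is_derive_psi_y s y : s != 0 ->
  is_derive y 1 (psi s) (s ^- 3 * (phi (y / s) - (y / s) ^+ 2 * phi (y / s))).
Proof.
move=> s0; rewrite /psi.
have D : is_derive y 1 (fun y => y / s) s^-1.
  rewrite (_ : (fun y => y / s) = (fun y => 0 + y * s^-1)); last by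
    apply/funext => z; rewrite add0r.
  exact: is_derive_affine.
apply: (is_derive_val (a := s ^- 2 * (y / s * (- (y / s * phi (y / s)) * s^-1)
  + phi (y / s) * s^-1))); last by field.
apply: is_derive_scale; apply: is_derive_mul => //.
exact: (is_derive_compose (is_derive_phi _)).
Qed.

Lemma is_derive_psi_s s y : s != 0 ->
  is_derive s 1 (psi^~ y)
   (s ^- 3 * ((y / s) ^+ 3 * phi (y / s) - 3 * (y / s * phi (y / s)))).
Proof.
move=> s0; rewrite /psi.
have I : is_derive s 1 (fun s => s^-1) (- s ^- 2).
  by apply: (is_derive_val (a := - s ^- 2 *: 1)); [exact: is_deriveV|exact: mulr1].
have D : is_derive s 1 (fun s => y / s) (y * - s ^- 2) by exact:
  (is_derive_scale y I).
rewrite (_ : (fun s => _) = (fun s => (s^-1 * s^-1) * (y / s * phi (y / s))));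
  last first.
  by apply/funext => t; rewrite expr2 invfM.
apply: (is_derive_val (a := (s^-1 * s^-1) * (y / s * (- (y / s * phi (y / s)) *
  (y * - s ^- 2)) + phi (y / s) * (y * - s ^- 2)) + (y / s * phi (y / s)) *
  (s^-1 * - s ^- 2 + s^-1 * - s ^- 2) )); last by field.
exact: (is_derive_mul (is_derive_mul I I)
  (is_derive_mul D (is_derive_compose (is_derive_phi _) D))).
Qed.

End deriv.

(** * Lindeberg's argument for two-point variables *)

Section lindeberg.
Context {R : realType}.
Implicit Types (h : R -> R) (a c s t x y z d : R) (cs : seq R).

Lemma expVn3_ge0 s : 0 < s -> 0 <= s ^- 3.
Proof. by move=> /ltW s0; rewrite invr_ge0 exprn_ge0. Qed.

Lemma expVn3_anti d s : 0 < d -> d <= s -> s ^- 3 <= d ^- 3.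
Proof.
move=> d0 ds; have s0 := lt_le_trans d0 ds.
by rewrite lef_pV2 ?posrE ?exprn_gt0// lerXn2r ?nnegrE// ltW.
Qed.

Lemma psi_lipschitz_y d s y z : 0 < d -> d <= s -> y <= z ->
  `|psi s z - psi s y| <= 18 * d ^- 3 * (z - y).
Proof.
move=> d0 ds yz.
have s0 : 0 < s by exact: lt_le_trans ds.
apply: (derive_lipschitz yz (fun u _ => is_derive_psi_y u (lt0r_neq0 s0))) => u _.
set w := u / s.
rewrite normrM [leLHS]mulrC [X in _ * X](ger0_norm (expVn3_ge0 s0)).
apply: ler_pM; rewrite ?normr_ge0 ?expVn3_ge0//.
  (* [18 = 9 + 9], from the exponents 0 and 2; in the same way the bound in [s] below has
     [36 = 9 + 3 * 9]. *)
  have := @powM_phi_le R 0 w isT; have := @powM_phi_le R 2 w isT.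
  rewrite mul1r real_normK ?num_real//.
  have := phi_ge0 w; have : 0 <= w ^+ 2 * phi w by rewrite mulr_ge0 ?sqr_ge0 ?phi_ge0.
  by move=> *; rewrite ler_norml; lra.
exact: expVn3_anti.
Qed.

Lemma psi_lipschitz_s d s t y : 0 < d -> d <= s -> s <= t ->
  `|psi t y - psi s y| <= 36 * d ^- 3 * (t - s).
Proof.
move=> d0 ds st.
have du u : s <= u <= t -> d <= u by case/andP => su _; exact: le_trans su.
have u0 u : s <= u <= t -> 0 < u by move/du; exact: lt_le_trans.
apply: (derive_lipschitz st (fun u su => is_derive_psi_s y (lt0r_neq0 (u0 u
  su)))) => u su.
have {}u0 := u0 u su; set w := y / u.
rewrite normrM [leLHS]mulrC [X in _ * X](ger0_norm (expVn3_ge0 u0)).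
apply: ler_pM; rewrite ?normr_ge0 ?expVn3_ge0//.
  have p0 := phi_ge0 w.
  have := @powM_phi_le R 1 w isT; have := @powM_phi_le R 3 w isT.
  rewrite expr1 -normrX -[X in _ * X](ger0_norm p0) -normrM => H3.
  rewrite -[X in _ * X](ger0_norm p0) -normrM => H1.
  apply: (le_trans (ler_normB _ _)); rewrite [X in _ + X]normrM
    [`|3|]ger0_norm//; lra.
exact: expVn3_anti d0 (du _ su).
Qed.

(** [54 = 36 + 18] adds the Lipschitz constants of [psi] in [s] and in [y]. *)
Definition lindeberg_const d : R := 54 * d ^- 3.

Lemma lindeberg_const_ge0 d : 0 < d -> 0 <= lindeberg_const d.
Proof. by move=> d0; rewrite mulr_ge0 ?expVn3_ge0. Qed.

(* One Lindeberg step: the two-point law is centred with variance p q c^2. *)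
Lemma Phi_two_point d p c s y : 0 < d -> d <= s -> 0 < p < 1 -> 0 <= c ->
  `|p * std_normal_cdf ((y + c * (1 - p)) / s)
    + (1 - p) * std_normal_cdf ((y - c * p) / s)
    - std_normal_cdf (y / Num.sqrt (s ^+ 2 + p * (1 - p) * c ^+ 2))|
  <= lindeberg_const d * c ^+ 3.
Proof.
move=> d0 ds /andP[p0 p1] c0.
have s0 : 0 < s by exact: lt_le_trans ds.
have sn0 := lt0r_neq0 s0.
set q := 1 - p; have q0 : 0 < q by rewrite subr_gt0.
have q1 : q < 1 by rewrite /q; lra.
set m := p * q; have m0 : 0 < m by rewrite mulr_gt0.
have m1 : m <= 1 by rewrite mulr_ile1 ?ltW.
pose S t : R := Num.sqrt (s ^+ 2 + m * t ^+ 2).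
have Sarg t : 0 < s ^+ 2 + m * t ^+ 2.
  by rewrite ltr_pwDl ?exprn_gt0// mulr_ge0 ?sqr_ge0 ?ltW.
have S0 t : 0 < S t by rewrite sqrtr_gt0.
have sS t : s <= S t.
  rewrite -[leLHS](ger0_norm (ltW s0)) -sqrtr_sqr ler_wsqrtr// lerDl.
  by rewrite mulr_ge0 ?sqr_ge0 ?ltW.
have Sst t : 0 <= t -> S t <= s + t.
  move=> t0; rewrite -[leRHS](ger0_norm (x := s + t)) ?addr_ge0 ?(ltW s0)//.
  rewrite -sqrtr_sqr ler_wsqrtr// sqrrD.
  have := sqr_ge0 t; have := mulr_ge0 (ltW s0) t0.
  have : m * t ^+ 2 <= 1 * t ^+ 2 by rewrite ler_wpM2r ?sqr_ge0.
  lra.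
(* The scale of the variable is deformed from 0 to [c]. The error [H] vanishes at 0, so a bound of
   order [c ^+ 2] on its derivative suffices. *)
pose H t := p * std_normal_cdf ((y + t * q) / s)
    + q * std_normal_cdf ((y - t * p) / s) - std_normal_cdf (y / S t).
pose dH t := m * (s^-1 * phi ((y + t * q) / s) - s^-1 * phi ((y - t * p) / s)
    + t * psi (S t) y).
have H0 : H 0 = 0.
  rewrite /H /S expr0n/= !mul0r mulr0 addr0 subr0 addr0 sqrtr_sqr (ger0_norm
    (ltW s0)).
  by rewrite /q; ring.
have HD t : is_derive t 1 H (dH t).
  have D1 (e b : R) : is_derive t 1 (fun t => (y + t * b) / s) (b / s).
    rewrite (_ : (fun t => _) = (fun t => y / s + t * (b / s))); last first.
      by apply/funext => u; ring.
    exact: is_derive_affine.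
  have DS : is_derive t 1 S (m * t / S t).
    have Di : is_derive t 1 (fun t => s ^+ 2 + m * (t * t)) (0 + m * (t * 1 + t * 1)).
      apply: is_derive_add; apply: is_derive_scale; exact: is_derive_mul.
    rewrite (_ : S = (fun t => Num.sqrt (s ^+ 2 + m * (t * t)))); last first.
      by apply/funext => u; rewrite /S expr2.
    apply: (is_derive_val (is_derive_compose (is_derive1_sqrt _) Di)).
      by rewrite -expr2.
    rewrite -expr2 -/(S t); have := lt0r_neq0 (S0 t) => ?; field.
    exact: lt0r_neq0 (S0 t).
  have DSV : is_derive t 1 (fun t => y / S t) (y * (- S t ^- 2 * (m * t / S t))).
    apply: is_derive_scale; exact: (is_deriveV (lt0r_neq0 (S0 t)) DS).
  have D3 := is_derive_compose (is_derive_Phi _) DSV.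
  have D1' := is_derive_scale p (is_derive_compose (is_derive_Phi _) (D1 0 q)).
  have D2' := is_derive_scale q (is_derive_compose (is_derive_Phi _) (D1 0 (- p))).
  rewrite (_ : H = (fun t => p * std_normal_cdf ((y + t * q) / s)
    + q * std_normal_cdf ((y + t * - p) / s) - std_normal_cdf (y / S t))); last first.
    by apply/funext => u; rewrite /H mulrN.
  apply: (is_derive_val (is_derive_sub (is_derive_add D1' D2') D3)).
  rewrite /dH /psi /m mulrN; have := lt0r_neq0 (S0 t) => ?; field.
  by apply/andP.
have dHle t : 0 <= t <= c -> `|dH t| <= lindeberg_const d * c ^+ 2.
  move=> /andP[t0 tc].
  have yy : y - t * p <= y + t * q by rewrite lerD2l; nra.
  (* The two arguments differ by exactly [t], so the difference of densities is [- t * psi s xi]; it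
     cancels [t * psi (S t) y] up to a variation of [psi]. *)
  have [x _||xi] := MVT_segment yy
     (f := fun y => s^-1 * phi (y / s)) (df := fun y => - psi s y).
  - exact: is_derive_density.
  - apply: derivable_within_continuous => x _.
    by have [] := is_derive_density x sn0.
  rewrite in_itv/= => /andP[xi1 xi2] E.
  have -> : dH t = m * t * ((psi (S t) y - psi s y) + (psi s y - psi s xi)).
    by rewrite /dH E /q; ring.
  have L1 := psi_lipschitz_s y d0 ds (sS t).
  have L2 : `|psi s y - psi s xi| <= 18 * d ^- 3 * t.
    have [yxi|xiy] := leP y xi.
      rewrite distrC (le_trans (psi_lipschitz_y d0 ds yxi))//.
      rewrite ler_wpM2l ?mulr_ge0 ?expVn3_ge0//; nra.
    rewrite (le_trans (psi_lipschitz_y d0 ds (ltW xiy)))//.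
    rewrite ler_wpM2l ?mulr_ge0 ?expVn3_ge0//; nra.
  have d3 := expVn3_ge0 d0.
  (* Both [S t - s] and the distance from [y] to [xi] are at most [t]. *)
  have L3 : `|psi (S t) y - psi s y + (psi s y - psi s xi)| <= 54 * d ^- 3 * t.
    rewrite (le_trans (ler_normD _ _))//.
    have : 36 * d ^- 3 * (S t - s) <= 36 * d ^- 3 * t.
      by rewrite ler_wpM2l ?mulr_ge0// lerBlDl Sst.
    lra.
  rewrite normrM [`|m * t|]ger0_norm ?(mulr_ge0 (ltW m0) t0)//.
  rewrite /lindeberg_const expr2 -[leLHS]mulrC [leRHS]mulrA.
  rewrite ler_pM ?(mulr_ge0 (ltW m0) t0)//.
    by rewrite (le_trans L3)// ler_wpM2l ?mulr_ge0.
  by rewrite (le_trans _ tc)// ler_piMl.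
have := derive_lipschitz c0 (fun x _ => HD x) dHle.
by rewrite H0 subr0 subr0 -mulrA -exprSr.
Qed.

End lindeberg.

(** * Central limit theorem for weighted two-point sums *)

Section clt.
Context {R : realType}.
Implicit Types (h g : R -> R) (a c s t x y z d : R) (cs : seq R).
Variable p : R.
Hypothesis p01 : 0 < p < 1.

(* two_point_mean cs h x is the expectation of h (x + \sum_i c_i (p - b_i)) for
   independent Bernoulli(p) variables b_i. *)
Fixpoint two_point_mean cs h x : R :=
  if cs is c :: cs' then
    p * two_point_mean cs' h (x - c * (1 - p)) + (1 - p) * two_point_mean cs' h
      (x + c * p)
  else h x.

Lemma two_point_mean_le cs h g x : (forall x, h x <= g x) -> two_point_mean cs
  h x <= two_point_mean cs g x.
Proof.
move=> hg; have /andP[p0 p1] := p01.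
elim: cs x => //= c cs IH x.
by rewrite lerD// ler_wpM2l// ?subr_ge0 ltW.
Qed.

Lemma two_point_mean_addr cs h e x : two_point_mean cs (fun x => h x + e) x =
  two_point_mean cs h x + e.
Proof.
elim: cs x => [//|c cs IH x] /=.
by rewrite !IH; ring.
Qed.

(** By induction the tail is replaced by a Gaussian widening of the scale to [s1], then the head by
    one step at scale [s1]. Scales only grow, so they stay above [d] and the same constant serves
    throughout. *)
Lemma two_point_mean_Phi d s cs a x : 0 < d -> d <= s -> all (fun c => 0 <= c) cs ->
  `|two_point_mean cs (fun x => std_normal_cdf ((a - x) / s)) x -
    std_normal_cdf ((a - x) /
      Num.sqrt (s ^+ 2 + p * (1 - p) * \sum_(c <- cs) c ^+ 2))|
  <= lindeberg_const d * \sum_(c <- cs) c ^+ 3.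
Proof.
move=> d0 ds; have s0 := lt_le_trans d0 ds; have /andP[p0 p1] := p01.
have q0 : 0 < 1 - p by rewrite subr_gt0.
elim: cs x => [|c cs IH] x /=.
  by move=> _; rewrite !big_nil !mulr0 addr0 sqrtr_sqr (ger0_norm (ltW s0))
    subrr normr0.
move=> /andP[c0 /IH{}IH]; rewrite !big_cons.
set s1 := Num.sqrt (s ^+ 2 + p * (1 - p) * \sum_(c <- cs) c ^+ 2) in IH.
have sum0 : 0 <= p * (1 - p) * \sum_(c <- cs) c ^+ 2.
  by rewrite mulr_ge0 ?sumr_ge0// => [|? _]; rewrite ?sqr_ge0 ?mulr_ge0 ?ltW.
have ss1 : s <= s1.
  by rewrite -[leLHS](ger0_norm (ltW s0)) -sqrtr_sqr ler_wsqrtr// lerDl.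
have step := Phi_two_point (a - x) d0 (le_trans ds ss1) p01 c0.
have {step} : `|p * std_normal_cdf ((a - (x - c * (1 - p))) / s1) +
   (1 - p) * std_normal_cdf ((a - (x + c * p)) / s1) -
   std_normal_cdf ((a - x) / Num.sqrt (s ^+ 2 + p * (1 - p) * (c ^+ 2 + \sum_(j
     <- cs) j ^+ 2)))|
   <= lindeberg_const d * c ^+ 3.
  rewrite (_ : a - (x - _) = a - x + c * (1 - p)); last by ring.
  rewrite (_ : a - (x + _) = a - x - c * p); last by ring.
  rewrite (_ : s ^+ 2 + _ = s1 ^+ 2 + p * (1 - p) * c ^+ 2)//.
  by rewrite sqr_sqrtr ?addr_ge0 ?sqr_ge0//; ring.
have := IH (x - c * (1 - p)); have := IH (x + c * p).
rewrite [lindeberg_const d * (_ + _)]mulrDr.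
set A := two_point_mean _ _ _; set B := two_point_mean _ _ _.
set A' := std_normal_cdf _; set B' := std_normal_cdf _; set D := std_normal_cdf _.
set K := lindeberg_const d * \sum_(j <- cs) j ^+ 3; set L := lindeberg_const d * _.
have pA : p * `|B - B'| <= p * K -> (1 - p) * `|A - A'| <= (1 - p) * K ->
   `|p * B' + (1 - p) * A' - D| <= L -> `|p * B + (1 - p) * A - D| <= L + K.
  move=> h1 h2 h3.
  rewrite (_ : _ - D = p * (B - B') + (1 - p) * (A - A') + (p * B' + (1 - p) *
    A' - D)); last by ring.
  rewrite (le_trans (ler_normD _ _))// (le_trans (lerD (ler_normD _ _) (lexx _)))//.
  by rewrite !normrM (gtr0_norm p0) (gtr0_norm q0); lra.
by move=> hA hB; apply: pA; rewrite ler_wpM2l// ltW.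
Qed.

(** Undoes the smoothing, which turns unit variance into [d ^+ 2 + 1]. *)
Lemma Phi_rescale s b : 1 <= s ->
  `|std_normal_cdf (b / s) - std_normal_cdf b| <= 9 * (s - 1).
Proof.
move=> s1.
have D u : 1 <= u <= s -> is_derive u 1 (fun u => std_normal_cdf (b / u))
    (phi (b / u) * (b * - u ^- 2)).
  case/andP => u1 _; have u0 : u != 0 by rewrite gt_eqF// (lt_le_trans _ u1).
  apply: (is_derive_compose (is_derive_Phi _)); apply: is_derive_scale.
  by apply: (is_derive_val (is_deriveV u0 (is_derive_id _ _))); exact: mulr1.
rewrite -{2}[b]divr1; apply: (derive_lipschitz s1 D) => u /andP[u1 _].
have u0 : 0 < u by rewrite (lt_le_trans _ u1).
rewrite (_ : _ * _ = - (b / u * phi (b / u) * u^-1)); last by field; rewrite gt_eqF.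
rewrite normrN normrM [X in X * _]normrM (ger0_norm (phi_ge0 _)).
have := powM_phi_le (b / u) (isT : (1 <= 4)%N); rewrite expr1 => H.
rewrite -[leRHS]mulr1 ler_pM ?mulr_ge0 ?phi_ge0//.
by rewrite normfV ger0_norm ?(ltW u0)// invf_le1.
Qed.

Theorem two_point_clt e : 0 < e -> exists2 eta, 0 < eta &
  forall cs, all (fun c => 0 <= c) cs ->
    p * (1 - p) * \sum_(c <- cs) c ^+ 2 = 1 ->
    \sum_(c <- cs) c ^+ 3 <= eta ->
    forall a, `|two_point_mean cs (fun x => (x <= a)%R%:R) 0 - std_normal_cdf a| <= e.
Proof.
move=> e0.
have e5 : 0 < e / 5 by rewrite divr_gt0.
have [M M0 [HM1 HM2]] := Phi_tails e5.
(* The shift by [h] costs [9 * h = e / 5]; with [d = h / (M + 1)] it exceeds [M] smoothing widths.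
   The replacement, the rescaling and the tails cost [e / 5] each. *)
pose h := e / 45; have h0 : 0 < h by rewrite divr_gt0.
pose d := h / (M + 1); have M1 : 0 < M + 1 by rewrite addr_gt0.
have d0 : 0 < d by rewrite divr_gt0.
have dh : d <= h by rewrite ler_pdivrMr// ler_peMr ?(ltW h0)// lerDr ltW.
have hd : h / d = M + 1 by rewrite /d; field; rewrite !gt_eqF.
have K0 := lindeberg_const_ge0 d0.
exists (e / 5 / (lindeberg_const d + 1)); first by rewrite divr_gt0// ltr_wpDl.
move=> cs cs0 V T a.
have KT : lindeberg_const d * \sum_(c <- cs) c ^+ 3 <= e / 5.
  apply: (le_trans (ler_wpM2l K0 T)).
  rewrite mulrCA ler_piMr ?(ltW e5)// ler_pdivrMr ?ltr_wpDl//; lra.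
pose S := Num.sqrt (d ^+ 2 + 1).
have S1 : 1 <= S.
  by rewrite -[leLHS]sqrtr1 ler_wsqrtr// lerDr sqr_ge0.
have Sd : S <= 1 + d.
  rewrite -[leRHS](ger0_norm (x := 1 + d)) ?addr_ge0 ?(ltW d0)//.
  by rewrite -sqrtr_sqr ler_wsqrtr// sqrrD; lra.
have main b : `|two_point_mean cs (fun x => std_normal_cdf ((b - x) / d)) 0 -
  std_normal_cdf b| <= e / 5 + e / 5.
  have := two_point_mean_Phi b 0 d0 (lexx d) cs0; rewrite V subr0 -/S => H1.
  have H2 := Phi_rescale b S1.
  rewrite (_ : _ - std_normal_cdf b = (two_point_mean cs (fun x =>
    std_normal_cdf ((b - x) / d)) 0 - std_normal_cdf (b / S)) + (std_normal_cdf
    (b / S) - std_normal_cdf b)); last by ring.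
  rewrite (le_trans (ler_normD _ _))// lerD ?(le_trans H1)// (le_trans H2)//.
  by rewrite /h in dh; lra.
(* The indicator lies between the smoothed steps centred at [a - h] and [a + h], up to the tail mass
   [e / 5]. *)
have up : two_point_mean cs (fun x => (x <= a)%R%:R) 0 <=
    two_point_mean cs (fun x => std_normal_cdf ((a + h - x) / d)) 0 + e / 5.
  rewrite -two_point_mean_addr; apply: two_point_mean_le => x; case: (leP x a)
    => xa /=.
    suff : std_normal_cdf M <= std_normal_cdf ((a + h - x) / d) by lra.
    apply: Phi_mono; rewrite ler_pdivlMr//.
    have : (M + 1) * d = h by rewrite /d; field; rewrite gt_eqF.
    by rewrite mulrDl mul1r; lra.
  by rewrite addr_ge0 ?Phi_ge0 ?(ltW e5).
have low : two_point_mean cs (fun x => std_normal_cdf ((a - h - x) / d)) 0 - e / 5 <=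
    two_point_mean cs (fun x => (x <= a)%R%:R) 0.
  rewrite -two_point_mean_addr; apply: two_point_mean_le => x; case: (leP x a)
    => xa /=.
    by have := Phi_le1 ((a - h - x) / d); lra.
  suff : std_normal_cdf ((a - h - x) / d) <= std_normal_cdf (- M) by lra.
  apply: Phi_mono; rewrite ler_pdivrMr//.
  have : (M + 1) * d = h by rewrite /d; field; rewrite gt_eqF.
  by rewrite mulrDl mul1r; lra.
have := main (a + h); have := main (a - h).
have ah : a <= a + h by rewrite lerDl ltW.
have ha : a - h <= a by rewrite gerBl ltW.
have := Phi_lipschitz ah; have := Phi_lipschitz ha.
rewrite !ler_norml => /andP[? ?] /andP[? ?] /andP[? ?] /andP[? ?].
have hE : h = e / 45 by [].
by clearbody h; apply/andP; split; lra.
Qed.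

End clt.

(** * Independent choices *)

Section cylinder.
Context d (T : measurableType d) (R : realType) (P : probability T R).
Variables (Z : nat -> T -> bool) (p : R).
Hypothesis mZ : forall n, measurable [set w | Z n w].
Hypothesis indZ : Z_independent P Z.
Hypothesis PZ : forall n, (2 <= n)%N -> P [set w | Z n w] = p%:E.

(** The sign is that of the chain: a crossing takes [2 - Z] steps, whose deviation from the mean
    [2 - p] is [p - Z]. *)
Fixpoint centred_sum (cs : seq R) (m : nat) (w : T) : R :=
  if cs is c :: cs' then c * (p - (Z m w)%:R) + centred_sum cs' m.+1 w else 0.

Let cyl (s : seq nat) (b : nat -> bool) := [set w | all (fun i => Z i w == b i) s].

Lemma measurable_fun_Z n : measurable_fun setT (Z n).
Proof.
apply: (measurable_fun_bool true).
by rewrite setTI; exact: mZ.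
Qed.

Lemma measurable_coord n b : measurable [set w | Z n w = b].
Proof.
case: b; first exact: mZ.
rewrite (_ : [set w | _] = ~` [set w | Z n w]); first exact: measurableC.
by apply/seteqP; split => w /=; case: (Z n w).
Qed.

Lemma cyl_cons n s b : cyl (n :: s) b = [set w | Z n w = b n] `&` cyl s b.
Proof.
by rewrite /cyl; apply/seteqP; split => w /=; [move=> /andP[/eqP]|move=> [->
  ->]; rewrite eqxx].
Qed.

Lemma measurable_cyl s b : measurable (cyl s b).
Proof.
elim: s => [|n s IH]; first by rewrite (_ : cyl _ _ = setT)//; apply/seteqP.
by rewrite cyl_cons; apply: measurableI => //; exact: measurable_coord.
Qed.

Lemma prob_coord n (b : bool) : (2 <= n)%N ->
  P [set w | Z n w = b] = (if b then p else 1 - p)%:E.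
Proof.
move=> n2; case: b; first exact: PZ.
rewrite (_ : [set w | _] = ~` [set w | Z n w]).
  by rewrite probability_setC// PZ.
by apply/seteqP; split => w /=; case: (Z n w).
Qed.

Lemma prob_cyl_cons n s b : uniq (n :: s) -> all (leq 2) (n :: s) ->
  P (cyl (n :: s) b) = ((if b n then p else 1 - p) * fine (P (cyl s b)))%:E.
Proof.
move=> u a; rewrite -[LHS]fineK ?fin_num_measure//; last exact: measurable_cyl.
congr EFin; rewrite /cyl (indZ b u a) big_cons; move: u a => /= /andP[_ u]
  /andP[n2 a].
by rewrite prob_coord// (indZ b u a).
Qed.

Lemma eq_cyl s b b' : {in s, b =1 b'} -> cyl s b = cyl s b'.
Proof.
move=> bb; rewrite /cyl; apply/seteqP; split => w /= /allP zb; apply/allP => i si.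
  by rewrite -bb// zb.
by rewrite bb// zb.
Qed.

(** No regularity of [h] enters: the sum depends on finitely many Booleans, so the function is built
    by branching on measurable events. *)
Lemma measurable_centred_sum (h : R -> R) cs m x :
  measurable_fun setT (fun w => h (x + centred_sum cs m w)).
Proof.
elim: cs m x => [|c cs IH] m x /=; first exact: measurable_cst.
rewrite (_ : (fun _ => _) = (fun w => if Z m w
   then h (x + c * (p - 1) + centred_sum cs m.+1 w) else h (x + c * (p - 0) +
     centred_sum cs m.+1 w))).
  by apply: measurable_fun_ifT => //; exact: measurable_fun_Z.
by apply/funext => w; rewrite addrA; case: (Z m w).
Qed.

(** Fixing coordinate [m] splits the cylinder in two, and independence multiplies its probability by
    [p] or [1 - p], as in [two_point_mean]. The cylinder records the coordinates fixed so far;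
    [h >= 0] gives additivity over the halves. *)
Lemma integral_cyl (h : R -> R) cs m x s b : (forall y, 0 <= h y) -> (2 <= m)%N ->
  uniq s -> all (fun i => 2 <= i < m)%N s ->
  (\int[P]_(w in cyl s b) (h (x + centred_sum cs m w))%:E)%E
    = (fine (P (cyl s b)) * two_point_mean p cs h x)%:E.
Proof.
move=> h0; elim: cs m x s b => [|c cs IH] m x s b m2 us sm /=.
  rewrite addr0 integral_cst; last exact: measurable_cyl.
  by rewrite EFinM fineK ?fin_num_measure 1?muleC//; exact: measurable_cyl.
pose bb (v : bool) i := if i == m then v else b i.
have ms : m \notin s by apply/negP => /(allP sm) /andP[_]; rewrite ltnn.
have cylbb v : cyl (m :: s) (bb v) = [set w | Z m w = v] `&` cyl s b.
  rewrite cyl_cons /bb eqxx; congr (_ `&` _); apply: eq_cyl => i si.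
  by case: eqP si ms => // -> ->.
have sm2 v : (\int[P]_(w in cyl (m :: s) (bb v)) (h (x + (c * (p - (Z m w)%:R)
  + centred_sum cs m.+1 w)))%:E)%E
  = ((if v then p else 1 - p) * fine (P (cyl s b)) * two_point_mean p cs h (x +
    c * (p - v%:R)))%:E.
  rewrite (eq_integral (fun w => (h (x + c * (p - v%:R) + centred_sum cs m.+1
    w))%:E)).
    have um : uniq (m :: s) by rewrite /= ms.
    have am : all (leq 2) (m :: s).
      by rewrite /= m2; apply/allP => i /(allP sm) /andP[].
    rewrite IH//.
    - rewrite prob_cyl_cons//= /bb eqxx; congr (_ * fine (P _) * _)%:E.
      by apply: eq_cyl => i si; case: eqP si ms => // -> ->.
    - by rewrite ltnW.
    - by rewrite /= m2 ltnSn/=; apply/allP => i /(allP sm) /andP[-> /ltnW].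
  by move=> w; rewrite inE cylbb => -[/= -> _]; rewrite addrA.
have cylE : cyl s b = cyl (m :: s) (bb true) `|` cyl (m :: s) (bb false).
  rewrite !cylbb -setIUl (_ : _ `|` _ = setT) ?setTI//.
  by apply/seteqP; split => w //= _; case: (Z m w); [left|right].
rewrite {1}cylE ge0_integral_setU.
- rewrite !sm2 -EFinD; congr EFin.
  rewrite (_ : c * (p - true%:R) = - (c * (1 - p))); last by rewrite mulr1n; ring.
  by rewrite subr0; ring.
- exact: measurable_cyl.
- exact: measurable_cyl.
- have /measurable_EFinP mf := measurable_centred_sum h (c :: cs) m x.
  exact: measurable_funS measurableT (@subsetT _ _) mf.
- by move=> w _; rewrite lee_fin.
- apply/disj_setPS => w; rewrite !cylbb => -[[/= -> _] [/= ]].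
  by [].
Qed.

Lemma expectation_centred_sum_ge0 (h : R -> R) cs x : (forall y, 0 <= h y) ->
  ('E_P[fun w => h (x + centred_sum cs 2 w)%R] = (two_point_mean p cs h x)%:E)%E.
Proof.
move=> h0; rewrite unlock.
have := integral_cyl cs x (m := 2) (s := [::]) (fun=> true) h0 isT isT isT.
rewrite (_ : cyl _ _ = setT) ?probability_setT ?mul1r//.
exact/seteqP.
Qed.

Lemma two_point_mean_sub (h g : R -> R) cs x :
  two_point_mean p cs (fun x => h x - g x) x = two_point_mean p cs h x -
    two_point_mean p cs g x.
Proof.
elim: cs x => [//|c cs IH x] /=.
by rewrite !IH; ring.
Qed.

Lemma expectation_centred_sum (h : R -> R) cs x :
  ('E_P[fun w => h (x + centred_sum cs 2 w)%R] = (two_point_mean p cs h x)%:E)%E.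
Proof.
(* Positive and negative parts both have finite expectation, so their difference is meaningful. *)
pose hp y := Num.max (h y) 0; pose hn y := Num.max (- h y) 0.
have hE : h = (fun y => hp y - hn y).
  apply/funext => y; rewrite /hp /hn; case: (leP (h y) 0) => h0.
    by rewrite max_l ?oppr_ge0// sub0r opprK.
  by rewrite max_r ?oppr_le0 ?ltW// subr0.
have Ep := expectation_centred_sum_ge0 (h := hp) cs x.
have En := expectation_centred_sum_ge0 (h := hn) cs x.
rewrite unlock in Ep En *; rewrite integralE.
under eq_integral do rewrite funeposE.
under [X in (_ - X)%E]eq_integral do rewrite funenegE.
rewrite [in RHS]hE two_point_mean_sub EFinB -Ep; last by move=> y; rewrite
  le_max lexx orbT.
rewrite -En; last by move=> y; rewrite le_max lexx orbT.
by congr (_ - _)%E; apply: eq_integral => w _; rewrite /hp /hn EFin_max.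
Qed.

Lemma probability_centred_sum_le cs x a :
  P [set w | x + centred_sum cs 2 w <= a] = (two_point_mean p cs (fun y => (y
    <= a)%R%:R) x)%:E.
Proof.
rewrite -expectation_centred_sum.
have m : measurable [set w | x + centred_sum cs 2 w <= a].
  have := measurable_centred_sum idfun cs 2 x => /(_ measurableT `]-oo,
    a]%classic (measurable_itv _)).
  by rewrite setTI set_itvE.
rewrite -expectation_indic//; congr expectation; apply/funext => w.
by rewrite indicE; congr (nat_of_bool _)%:R; apply/idP/idP; rewrite inE.
Qed.

Lemma two_point_mean_id cs x : two_point_mean p cs idfun x = x.
Proof. by elim: cs x => //= c cs IH x; rewrite !IH; ring. Qed.

Lemma two_point_mean_sqr cs x y :
  two_point_mean p cs (fun t => (t - y) ^+ 2) x
  = (x - y) ^+ 2 + p * (1 - p) * \sum_(c <- cs) c ^+ 2.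
Proof.
elim: cs x => [|c cs IH] x /=; first by rewrite big_nil mulr0 addr0.
by rewrite !IH big_cons; ring.
Qed.

End cylinder.

(** * Moments and normal limit of the Gutman index *)

Section chain_moments.
Context d (T : measurableType d) (R : realType) (P : probability T R).
Variables (Z : nat -> T -> bool) (p : R) (u1 : 'I_5) (sel : nat -> bool).
Hypothesis mZ : forall n, measurable [set w | Z n w].
Hypothesis indZ : Z_independent P Z.
Hypothesis PZ : forall n, (2 <= n)%N -> P [set w | Z n w] = p%:E.

Definition coef (n m : nat) : R := 144 * m%:R * (n.-1%:R - m%:R).

Lemma centred_sumE (f : nat -> R) m k w :
  centred_sum Z p [seq f i | i <- iota m k] m.+1 w
  = \sum_(i <- iota m k) f i * (p - (Z i.+1 w)%:R).
Proof.
by elim: k m => [|k IH] m /=; rewrite ?big_nil// big_cons IH.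
Qed.

Lemma gut_centred_sum n : exists x, forall w, (gut_PG n u1 sel (Z ^~ w))%:R
  = x + centred_sum Z p [seq coef n i | i <- index_iota 1 n.-1] 2 w.
Proof.
have [C HC] := gut_PG_affine n u1 sel.
(* Each [delta m] is its mean [2 - p] plus [p - Z m.+1]; the means join the constant. *)
exists (C%:R + \sum_(m <- index_iota 1 n.-1) (2 - p) * coef n m) => w.
rewrite HC natrD natr_sum centred_sumE -addrA -big_split/=; congr (_ + _).
transitivity (\sum_(1 <= m < n.-1)
  (((if Z m.+1 w then 1 else 2) * (144 * m * (n.-1 - m)))%N%:R : R)).
  rewrite big_mkcond/=.
  rewrite -(big_mkord xpredT (fun m => if inner n m then (((if Z m.+1 w then 1
    else 2) * (144 * m * (n.-1 - m)))%N%:R : R) else 0)).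
  rewrite [RHS](big_nat_widen _ _ n) ?leq_pred//.
  rewrite [RHS](big_nat_widenl 1 0)// [RHS]big_mkcond/=.
  apply: eq_big_nat => m /andP[_ mn]; rewrite /inner.
  by congr (if _ then _ else _); apply/idP/idP; lia.
apply: eq_big_nat => m /andP[_ mn].
rewrite /coef natrM !natrM natrB; last by rewrite ltnW.
by case: (Z m.+1 w) => /=; ring.
Qed.

(** Expands into the power sums of exponents 2, 3 and 4. The parameter [a] stays fixed while [N]
    varies, which makes induction possible; it is set to [N] afterwards. *)
Lemma sum_sqr_prod (a : R) N :
  30 * \sum_(0 <= m < N) (m%:R * (a - m%:R)) ^+ 2
  = 5 * a ^+ 2 * ((N%:R - 1) * N%:R * (2 * N%:R - 1))
    - 15 * a * ((N%:R - 1) * N%:R) ^+ 2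
    + (N%:R - 1) * N%:R * (2 * N%:R - 1) * (3 * N%:R ^+ 2 - 3 * N%:R - 1).
Proof.
elim: N => [|N IH]; first by rewrite big_geq//; ring.
by rewrite big_nat_recr//= mulrDr IH -natr1; ring.
Qed.

Lemma sum_coef_sqr n : (1 <= n)%N ->
  30 * \sum_(m <- index_iota 1 n.-1) coef n m ^+ 2
  = 144 ^+ 2 * (n.-1%:R ^+ 5 - n.-1%:R).
Proof.
case: n => // N _; rewrite /coef /=.
have E : \sum_(1 <= m < N) (144 * m%:R * (N%:R - m%:R)) ^+ 2
   = 144 ^+ 2 * \sum_(0 <= m < N) (m%:R * (N%:R - m%:R)) ^+ 2 :> R.
  rewrite big_distrr/=; case: N => [|N]; first by rewrite !big_geq.
  rewrite [RHS]big_ltn// mul0r expr0n mulr0 add0r.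
  by apply: eq_bigr => m _; rewrite -exprMn mulrA.
by rewrite E mulrCA sum_sqr_prod; ring.
Qed.

Let X n w : R := (gut_PG n u1 sel (Z ^~ w))%:R.

(** The same [x] is the constant of the decomposition and the mean, so the fluctuation of [X n] is
    exactly the centred sum. *)
Lemma gut_moments n : exists2 x, forall w,
   X n w = x + centred_sum Z p [seq coef n i | i <- index_iota 1 n.-1] 2 w &
  ('E_P[X n] = x%:E)%E /\
  'V_P[X n] = (p * (1 - p) * \sum_(m <- index_iota 1 n.-1) coef n m ^+ 2)%:E.
Proof.
have [x Hx] := gut_centred_sum n; exists x => //.
have E : ('E_P[X n] = x%:E)%E.
  have -> : X n = (fun w => idfun (x + centred_sum Z p [seq coef n i | i <-
    index_iota 1 n.-1] 2 w)).
    exact/funext.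
  by rewrite (expectation_centred_sum mZ indZ PZ) two_point_mean_id.
split=> //; rewrite /variance unlock E.
rewrite (_ : (_ * _)%R = (fun w => (fun y => (y - x) ^+ 2) (x + centred_sum Z p
  [seq coef n i | i <- index_iota 1 n.-1] 2 w))).
  rewrite (expectation_centred_sum mZ indZ PZ (fun y => (y - x) ^+ 2)); congr EFin.
  by rewrite two_point_mean_sqr subrr expr0n add0r big_map.
by apply/funext => w; rewrite /= fctE /= /X Hx expr2.
Qed.

End chain_moments.

Lemma coef_ge0 (R : realType) n m : (m <= n.-1)%N -> 0 <= coef R n m.
Proof. by move=> mn; rewrite /coef mulr_ge0 ?mulr_ge0// subr_ge0 ler_nat. Qed.

Lemma coef_le (R : realType) n m : (m <= n.-1)%N -> coef R n m <= 144 * n.-1%:R ^+ 2.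
Proof.
move=> mn; rewrite /coef -mulrA ler_wpM2l// expr2 ler_pM//.
- by rewrite subr_ge0 ler_nat.
- by rewrite ler_nat.
- by rewrite gerBl.
Qed.

(* Lyapunov ratio: the cubes sum to at most the largest coefficient (order n^2)
   times the variance, whose square root has order n^(5/2). *)
Lemma lyapunov_ratio (R : realType) (p eta : R) n :
  let s := Num.sqrt (p * (1 - p) * \sum_(m <- index_iota 1 n.-1) coef R n m ^+ 2) in
  0 < p < 1 -> 0 < eta -> (3 <= n)%N ->
  60 / ((p * (1 - p)) ^+ 3 * eta ^+ 2) <= n.-1%:R ->
  0 < s /\ \sum_(m <- index_iota 1 n.-1) (coef R n m / s) ^+ 3 <= eta.
Proof.
move=> s /andP[p0 p1] eta0 n3 nbig.
set q := p * (1 - p) in s nbig *.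
have p1' : 0 < 1 - p by rewrite subr_gt0.
have q0 : 0 < q by rewrite mulr_gt0.
set N : R := n.-1%:R in nbig *.
have N2 : 2 <= N by rewrite /N ler_nat; lia.
have S30 := @sum_coef_sqr R n (ltnW (ltnW n3)).
rewrite -/N in S30; set V := \sum_(m <- _) coef R n m ^+ 2 in s S30 *.
have N5 : N ^+ 5 / 2 <= N ^+ 5 - N.
  have : N * 2 <= N * N ^+ 4.
    rewrite ler_wpM2l//.
    rewrite (_ : N ^+ 4 = (N * N) * (N * N)); last by ring.
    by have : 4 <= N * N; nra.
  by rewrite -exprS; lra.
have Vge : 144 ^+ 2 * N ^+ 5 / 60 <= V.
  have := ler_wpM2l (ler0n R (144 ^ 2)) N5; rewrite natrX -S30; lra.
have N0 : 0 < N by rewrite (lt_le_trans _ N2).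
have V0 : 0 < V.
  by rewrite (lt_le_trans _ Vge)// divr_gt0// mulr_gt0 ?exprn_gt0.
have s0 : 0 < s by rewrite sqrtr_gt0 mulr_gt0.
have s2 : s ^+ 2 = q * V by rewrite sqr_sqrtr// mulr_ge0 ?ltW.
split=> //.
have step : \sum_(m <- index_iota 1 n.-1) (coef R n m / s) ^+ 3 <= 144 * N ^+ 2
  / (q * s).
  (* One factor of each cube is bounded by [144 * N ^+ 2]; the remaining squares sum to [V], and
     [s ^+ 2 = q * V]. *)
  apply: (@le_trans _ _ (144 * N ^+ 2 / s ^+ 3 * V)).
    rewrite /V big_distrr/= !big_seq ler_sum// => m; rewrite mem_index_iota =>
      /andP[_ mn].
    rewrite expr_div_n [in leLHS]exprS mulrAC ler_wpM2r ?sqr_ge0//.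
    by rewrite ler_wpM2r ?invr_ge0 ?exprn_ge0 ?(ltW s0)// coef_le// ltnW.
  rewrite [s ^+ 3]exprSr s2 le_eqVlt; apply/orP; left; apply/eqP; field.
  by rewrite !gt_eqF.
rewrite (le_trans step)// ler_pdivrMr ?mulr_gt0//.
(* Squaring removes the root in [s] and leaves a comparison with the lower bound [Vge]. *)
rewrite -(@ler_pXn2r _ 2) ?nnegrE ?mulr_ge0 ?sqr_ge0 ?(ltW eta0) ?(ltW p0)
  ?(ltW p1') ?(ltW s0)//.
rewrite [leRHS]exprMn [(q * s) ^+ 2]exprMn s2.
have H1 : 60 <= N * (q ^+ 3 * eta ^+ 2).
  by rewrite -ler_pdivrMr// mulr_gt0 ?exprn_gt0.
have H2 : q ^+ 3 * eta ^+ 2 * (144 ^+ 2 * N ^+ 5 / 60) <= q ^+ 3 * eta ^+ 2 * V.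
  by rewrite ler_wpM2l// mulr_ge0 ?exprn_ge0 ?(ltW q0) ?(ltW eta0).
rewrite (_ : eta ^+ 2 * _ = q ^+ 3 * eta ^+ 2 * V); last by ring.
rewrite (le_trans _ H2)//.
rewrite [leRHS](_ : _ = 144 ^+ 2 * N ^+ 4 / 60 * (N * (q ^+ 3 * eta ^+ 2)));
  last by ring.
rewrite (_ : (144 * N ^+ 2) ^+ 2 = 144 ^+ 2 * N ^+ 4 / 60 * 60); last by field.
by rewrite ler_wpM2l// divr_ge0// mulr_ge0 ?exprn_ge0.
Qed.

Lemma centred_sum_scale d (T : measurableType d) (R : realType) (Z : nat -> T -> bool)
    (p c : R) cs m w :
  centred_sum Z p [seq x * c | x <- cs] m w = centred_sum Z p cs m w * c.
Proof. by elim: cs m => [|x cs IH] m /=; rewrite ?mul0r// IH mulrDl mulrAC. Qed.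

Theorem theorem3p1 (d : measure_display) (T : measurableType d) (R : realType)
  (P : probability T R) (Z : nat -> T -> bool) (p1 : R)
  (u1 : 'I_5) (sel : nat -> bool) :
  (forall n, measurable [set w | Z n w]) ->
  Z_independent P Z ->
  (forall n, (2 <= n)%N -> P [set w | Z n w] = p1%:E) ->
  0 < p1 < 1 ->
  let X := fun (n : nat) (w : T) => ((gut_PG n u1 sel (Z ^~ w))%:R : R) in
  let s1 := 288 ^+ 2 * p1 + 432 ^+ 2 * (1 - p1)
            - (288 * p1 + 432 * (1 - p1)) ^+ 2 in
  let s1t := 156 ^+ 2 * p1 + 300 ^+ 2 * (1 - p1)
            - (156 * p1 + 300 * (1 - p1)) ^+ 2 in
  let r1 := 288 * 156 * p1 + 432 * 300 * (1 - p1)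
            - (288 * p1 + 432 * (1 - p1)) * (156 * p1 + 300 * (1 - p1)) in
  (forall n : nat, (1 <= n)%N ->
     'V_P[X n] =
     ((1 / 30) * (s1 * n%:R ^+ 5 - 5 * r1 * n%:R ^+ 4 + 10 * s1t * n%:R ^+ 3
        + (65 * r1 - 30 * s1 - 45 * s1t) * n%:R ^+ 2
        + (59 * s1 + 65 * s1t - 120 * r1) * n%:R
        + (60 * r1 - 30 * s1 - 30 * s1t)))%:E) /\
  ((fun n : nat =>
      sup [set `| fine (P [set w | (X n w - fine 'E_P[X n]%E)
                                      / Num.sqrt (fine 'V_P[X n]) <= a])
                  - std_normal_cdf a | | a in [set: R]]) @ \oo --> (0%R : R^o)).
Proof.
move=> mZ indZ PZ p01 X s1 s1t r1; split=> [n n1|].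
  have [x _ [_ ->]] := gut_moments u1 sel mZ indZ PZ n.
  congr EFin; apply: (@mulfI _ 30); first by rewrite pnatr_eq0.
  (* Both pairs of values differ by 144, so [s1], [s1t] and [r1] all equal
     [144 ^+ 2 * p1 * (1 - p1)], and the polynomial collapses to [(n - 1) ^+ 5 - (n - 1)] times
     this. *)
  rewrite mulrCA sum_coef_sqr// /s1 /s1t /r1.
  rewrite (_ : n%:R = n.-1%:R + 1); last by rewrite natr1 prednK.
  by field.
apply/cvgrPdist_le => e e0.
have [eta eta0 clt] := two_point_clt p01 e0.
exists (Num.truncn (60 / ((p1 * (1 - p1)) ^+ 3 * eta ^+ 2))).+4 => // n /= nN.
have [x Hx [EX VX]] := gut_moments u1 sel mZ indZ PZ n.
rewrite EX VX /=; set s := Num.sqrt _.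
have [||s0 lyap] := @lyapunov_ratio R p1 eta n p01 eta0; rewrite -/s.
- by rewrite (leq_trans _ nN).
- rewrite ltW// (lt_le_trans (truncnS_gt _))// ler_nat.
  by move: (Num.truncn _) nN => t tn; lia.
(* Dividing by the standard deviation gives the unit variance required by [two_point_clt]. *)
pose cs := [seq c * s^-1 | c <- [seq coef R n i | i <- index_iota 1 n.-1]].
have cs0 : all (fun c => 0 <= c) cs.
  rewrite !all_map; apply/allP => m; rewrite mem_index_iota /= => /andP[_ mn].
  by rewrite mulr_ge0 ?invr_ge0 ?(ltW s0)// coef_ge0// ltnW.
have cs2 : p1 * (1 - p1) * \sum_(c <- cs) c ^+ 2 = 1.
  rewrite !big_map; under eq_bigr do rewrite exprMn.
  rewrite -big_distrl/= mulrA -[X in X * _]sqr_sqrtr -/s.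
    by rewrite -exprMn divff ?expr1n// gt_eqF.
  rewrite ltW// -sqrtr_gt0; exact: s0.
have cs3 : \sum_(c <- cs) c ^+ 3 <= eta by rewrite !big_map.
have E a : `|fine (P [set w | (X n w - x) / s <= a]) - std_normal_cdf a| <= e.
  have := clt cs cs0 cs2 cs3 a.
  have := probability_centred_sum_le mZ indZ PZ cs 0 a.
  rewrite (_ : [set w | 0 + _ <= a] = [set w | (X n w - x) / s <= a]) => [->//|].
  by apply/seteqP; split => w /=; rewrite /cs centred_sum_scale add0r /X Hx
    addrC addKr//.
rewrite sub0r normrN.
set S := [set _ | _ in _].
have Se : ubound S e by move=> _ [a _ <-]; exact: E.
(* A member of [S] shows both that it is nonempty and that its supremum is nonnegative. *)
have S0 : S `|fine (P [set w | (X n w - x) / s <= 0]) - std_normal_cdf 0| by exists 0.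
rewrite ger0_norm; first by apply: ge_sup => //; eexists; exact: S0.
by rewrite (le_trans _ (ub_le_sup _ S0))//; exists e.
Qed.
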